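(* Let $(X,d)$ be an $\mathbb{R}$-tree and let $A\subseteq X$ be a nonempty, convex and geodesically bounded set. Then in the Lion-Man game played in $A$ physical capture always occurs: for every $D>0$, all starting points $L_0,M_0\in A$ and every admissible sequence of moves of the man, there exists $n_0\in\mathbb{N}$ such that $d(L_{n_0},M_{n_0})\le D$.
   Context: A geodesic segment joining $x,y$ in a metric space is the image of an isometric embedding $\gamma:[a,b]\to X$ with $\gamma(a)=x$, $\gamma(b)=y$. $X$ is uniquely geodesic if every two points $x,y$ are joined by a unique geodesic segment, denoted $[x,y]$. An $\mathbb{R}$-tree is a uniquely geodesic space $X$ such that if $x,y,z\in X$ satisfy $[y,x]\cap[x,z]=\{x\}$, then $[y,x]\cup[x,z]=[y,z]$. $A$ is convex if $[x,y]\subseteq A$ for all $x,y\in A$. A geodesic ray is (the image of) a map $\gamma:[0,\infty)\to X$ with $d(\gamma(s),\gamma(t))=|s-t|$ for all $s,t\ge0$; a set is geodesically bounded if it contains no geodesic ray. Lion-Man game in $A$: take $D>0$ and starting points $L_0,M_0\in A$ of the lion and the man. At step $n+1$, $n\in\mathbb{N}=\{0,1,2,\dots\}$, the lion moves from $L_n$ to the point $L_{n+1}\in[L_n,M_n]$ with $d(L_n,L_{n+1})=\min\{D,d(L_n,M_n)\}$, and the man moves from $M_n$ to a point $M_{n+1}\in A$ with $d(M_n,M_{n+1})\le D$ (an admissible move). *)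

(* Defs.v *)
From HB Require Import structures.
From mathcomp Require Import all_boot all_order all_algebra.
From mathcomp Require Import all_classical all_reals all_analysis.

Set Implicit Arguments.
Unset Strict Implicit.
Unset Printing Implicit Defensive.

Import Order.TTheory GRing.Theory Num.Theory.

Local Open Scope classical_set_scope.
Local Open Scope ring_scope.

Section RTree.
Context {R : realType} {X : metricType R}.

Definition isometric_on (I : interval R) (gamma : R -> X) : Prop :=
  {in I &, forall s t, mdist (gamma s) (gamma t) = `|s - t|}.

Definition geodesic_segment (x y : X) (S : set X) : Prop :=
  exists (a b : R) (gamma : R -> X),
    [/\ a <= b, isometric_on `[a, b] gamma, gamma a = x, gamma b = y
      & S = gamma @` `[a, b]].

(* [x, y]: a chosen geodesic segment joining x and y (set0 if there is none).
   In a uniquely geodesic space this is the unique such segment. *)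
Definition segment (x y : X) : set X := xget set0 (geodesic_segment x y).

Definition convex_subset (A : set X) : Prop :=
  forall x y, A x -> A y -> segment x y `<=` A.

Definition geodesic_ray (S : set X) : Prop :=
  exists2 gamma : R -> X,
    isometric_on `[0, +oo[ gamma & S = gamma @` `[0, +oo[.

Definition geodesically_bounded (A : set X) : Prop :=
  ~ exists2 S : set X, geodesic_ray S & S `<=` A.

Record lion_man_game (A : set X) (D : R) (L M : nat -> X) : Prop := {
  lion_start : A (L 0%N);
  man_start : A (M 0%N);
  lion_segment : forall n, segment (L n) (M n) (L n.+1);
  lion_step : forall n,
    mdist (L n) (L n.+1) = Num.min D (mdist (L n) (M n));
  man_mem : forall n, A (M n.+1);
  man_step : forall n, mdist (M n) (M n.+1) <= D }.

End RTree.

Definition uniquely_geodesic (R : realType) (X : metricType R) : Prop :=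
  forall x y : X, exists! S : set X, geodesic_segment x y S.

Definition R_tree (R : realType) (X : metricType R) : Prop :=
  uniquely_geodesic X /\
  forall x y z : X, segment y x `&` segment x z = [set x] ->
    segment y x `|` segment x z = segment y z.

(* Main.v *)
(** Suppose the lion never gets within [D] of the man.  Then the lion moves by
    exactly [D] at every step, and his path never turns back: from [L (n+1)],
    the man cannot leave the direction he had as seen from [L n], since in a
    tree he would have to pass through [L (n+1)] during his move and would thus
    end up within [D] of the lion.  So the segments [[L n, L (n+1)]] are glued
    without backtracking, and in a tree a path without backtracking is
    geodesic.  Their union is a geodesic ray in [A]. *)
Require Import Defs.
From mathcomp Require Import all_boot all_order all_algebra.
From mathcomp Require Import all_classical all_reals all_analysis.
From mathcomp Require Import lra.

Local Open Scope classical_set_scope.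
Local Open Scope ring_scope.

Import Order.TTheory GRing.Theory Num.Theory.

Section Betweenness.
Context {R : realType} {X : metricType R}.
Implicit Types a m p q x y z : X.

(** In an R-tree this amounts to [p] lying on the segment from [x] to [z], so geodesic arguments
    become linear arithmetic. *)
Definition between x p z := mdist x p + mdist p z = mdist x z.

Lemma between_sym {x p z} : between x p z -> between z p x.
Proof. by rewrite /between addrC !(metric_sym _ z) (metric_sym x). Qed.

Lemma between_inner_right {a x p m} :
  between a x m -> between x p m -> between a x p.
Proof.
rewrite /between => axm xpm.
have := metric_triangle a p m; have := metric_triangle a x p; lra.
Qed.

Lemma between_outer_right {a x p m} :
  between a x m -> between x p m -> between a p m.
Proof.
move=> axm xpm; have := between_inner_right axm xpm.
by rewrite /between in axm xpm *; lra.
Qed.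

Lemma between_outer_left {a x p m} :
  between a p m -> between a x p -> between a x m.
Proof.
by move=> /between_sym apm /between_sym axp; apply/between_sym/(between_outer_right apm).
Qed.

Lemma between_antisym {a x p} : between a x p -> between a p x -> x = p.
Proof.
rewrite /between (metric_sym p) => axp apx; apply: mdist_positivity; lra.
Qed.

End Betweenness.

Section Trees.
Context {R : realType} {X : metricType R} (treeX : R_tree X).
Implicit Types a m p q x y z : X.

Lemma segment_geodesic x y : geodesic_segment x y (segment x y).
Proof.
by case: treeX => uniqX _; have [S [xyS _]] := uniqX x y; apply: xgetI xyS.
Qed.

Lemma mdist_segment {x y p q} : segment x y p -> segment x y q ->
  mdist p q = `|mdist x p - mdist x q|.
Proof.
have [a [b [g [ab iso <- <- ->]]]] := segment_geodesic x y.
have aI : a \in `[a, b] by rewrite in_itv/= lexx.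
move=> [s sI <-] [t tI <-]; rewrite !iso//.
move: sI tI; rewrite /= !in_itv/= => /andP[as_ _] /andP[at_ _].
rewrite !(distrC a) (ger0_norm (x := s - a)) ?(ger0_norm (x := t - a)) ?subr_ge0//.
by congr Num.norm; lra.
Qed.

Lemma segment_left x y : segment x y x.
Proof.
have [a [b [g [ab _ <- _ ->]]]] := segment_geodesic x y.
by exists a => //=; rewrite in_itv/= lexx.
Qed.

Lemma segment_right x y : segment x y y.
Proof.
have [a [b [g [ab _ _ <- ->]]]] := segment_geodesic x y.
by exists b => //=; rewrite in_itv/= lexx andbT.
Qed.

Lemma segment_point {x y} (t : R) : 0 <= t <= mdist x y ->
  exists2 p, segment x y p & mdist x p = t.
Proof.
have [a [b [g [ab iso <- <- ->]]]] := segment_geodesic x y.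
have aI : a \in `[a, b] by rewrite in_itv/= lexx.
have bI : b \in `[a, b] by rewrite in_itv/= lexx andbT.
rewrite iso// distrC ger0_norm ?subr_ge0// => /andP[t0 tab].
have atI : a + t \in `[a, b] by rewrite in_itv/=; apply/andP; split; lra.
exists (g (a + t)); first by exists (a + t).
by rewrite iso// opprD addNKr normrN ger0_norm.
Qed.

(** For the converse, the tree axiom glues the segments from [x] to [p] and from [p] to [y]: a
    common point lies both before and after [p], hence is [p]. *)
Lemma segment_between x p y : segment x y p <-> between x p y.
Proof.
have segB u q v : segment u v q -> between u q v.
  have [a [b [g [ab iso <- <- ->]]]] := segment_geodesic u v.
  move=> [s sI <-].
  have aI : a \in `[a, b] by rewrite in_itv/= lexx.
  have bI : b \in `[a, b] by rewrite in_itv/= lexx andbT.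
  rewrite /between !iso//.
  move: sI; rewrite /= in_itv/= => /andP[as_ sb].
  by rewrite !(distrC _ b) !(distrC a) !ger0_norm ?subr_ge0//; lra.
split=> [/segB//|xpy].
case: treeX => _ /(_ p x y) <-; first by left; exact: segment_right.
rewrite eqEsubset; split=> [q [/segB xqp /segB pqy]|_ ->].
  exact: between_antisym xqp (between_inner_right xpy pqy).
by split; [exact: segment_right|exact: segment_left].
Qed.

Lemma tree_between {x y z} :
  (forall p, between y p x -> between x p z -> p = x) -> between y x z.
Proof.
move=> meet_x; apply/segment_between.
case: treeX => _ /(_ x y z) <-; first by left; exact: segment_right.
rewrite eqEsubset; split=> [q [/segment_between yqx /segment_between xqz]|_ ->].
  exact: meet_x.
by split; [exact: segment_right|exact: segment_left].
Qed.

(** Let [q] be common to the segments from [a] to [x] and from [x] to [m]. The detour from [a]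
    through [q] to [p] gives d(x,q) + d(x,p) <= |d(x,q) - d(x,p)|, so d(x,q) = 0 because d(x,p) >
    0. *)
Lemma between_glue {a x p m} :
  x != p -> between a x p -> between x p m -> between a x m.
Proof.
rewrite -mdist_gt0 => xp axp xpm; apply: tree_between => q aqx xqm.
apply/esym/mdist_positivity; apply/eqP; rewrite eq_le mdist_ge0 andbT.
move/segment_between: xpm => /mdist_segment/(_ ((segment_between _ _ _).2 xqm)).
have := metric_triangle a q p.
move: axp aqx; rewrite /between (metric_sym q x) (metric_sym q p).
by case: (lerP (mdist x q) (mdist x p)) => ?; lra.
Qed.

(* If [x] did not separate [a] from [m'], the geodesic from [m] to [m'] would
   run through [x]. *)
Lemma between_short_move {a x m m'} :
  between a x m -> mdist m m' < mdist x m' -> between a x m'.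
Proof.
move=> axm mm'; apply: contrapT => naxm'.
suff : between m x m'.
  by rewrite /between => mxm'; have := mdist_ge0 m x; lra.
(* A common point [p != x] of the segments from [x] to [m] and to [m'] would allow gluing along the
   segment from [x] to [p]. *)
apply: tree_between => p /between_sym xpm xpm'; apply: contrapT => /eqP px.
apply: naxm'; apply: (@between_glue _ _ p) => //; first by rewrite eq_sym.
exact: between_inner_right axm xpm.
Qed.

(** The ray is the increasing union of the segments from [u 0] to [u n], parametrized by the
    distance to [u 0]. *)
Lemma straight_chain_ray {A : set X} {D : R} {u : nat -> X} :
  convex_subset A -> 0 < D -> (forall n, A (u n)) ->
  (forall n, mdist (u n) (u n.+1) = D) ->
  (forall n, between (u n) (u n.+1) (u n.+2)) ->
  exists2 S : set X, geodesic_ray S & S `<=` A.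
Proof.
move=> cvxA D0 Au uD uB.
have u0B n : between (u 0%N) (u n) (u n.+1).
  elim: n => [|n IH]; first by rewrite /between mdistxx add0r.
  (* Read backwards from [u n.+2], the two pieces overlap in a segment of length [D > 0]. *)
  apply: between_sym; apply: between_glue (between_sym (uB n)) (between_sym IH).
  by rewrite -mdist_gt0 metric_sym uD.
have u0D n : mdist (u 0%N) (u n) = n%:R * D.
  elim: n => [|n IH]; first by rewrite mdistxx mul0r.
  by rewrite -u0B IH uD mulrSr mulrDl mul1r.
have nested k n p : segment (u 0%N) (u n) p -> segment (u 0%N) (u (k + n)%N) p.
  move=> np; elim: k => // k /segment_between kp.
  exact/segment_between/(between_outer_left (u0B _) kp).
pose on_ray t := [set p | mdist (u 0%N) p = t /\
  exists n, segment (u 0%N) (u n) p].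
pose gamma t := xget (u 0%N) (on_ray t).
have gammaP t : 0 <= t -> on_ray t (gamma t).
  move=> t0; apply: xgetPex.
  (* The segment from [u 0] to [u n] has length [n * D], which exceeds [t] for this [n]. *)
  pose n := Num.bound (t / D).
  have tn : 0 <= t <= mdist (u 0%N) (u n).
    rewrite t0 u0D -ler_pdivrMr// ltW// archi_boundP//.
    by rewrite divr_ge0// ltW.
  by have [p np pt] := segment_point t tn; exists p; split=> //; exists n.
exists (gamma @` `[0, +oo[).
  exists gamma => // s t; rewrite !in_itv/= !andbT => /gammaP[ds [m sm]].
  move=> /gammaP[dt [n tn]].
  (* Both points lie on one segment from [u 0], where distances are differences of distances to
     [u 0]. *)
  have := nested m _ _ tn; have := nested n _ _ sm; rewrite addnC => sN tN.
  by rewrite (mdist_segment sN tN) ds dt.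
move=> _ [t tI <-]; move: tI; rewrite /= in_itv/= andbT => /gammaP[_ [n]].
exact: cvxA.
Qed.

End Trees.

Theorem mainTheorem9 (R : realType) (X : metricType R) (A : set X)
    (treeX : R_tree X) (A_nonempty : A !=set0) (A_convex : convex_subset A)
    (A_bounded : geodesically_bounded A)
    (D : R) (D_gt0 : 0 < D) (L M : nat -> X)
    (game : lion_man_game A D L M) :
  exists n0 : nat, mdist (L n0) (M n0) <= D.
Proof.
apply: contrapT => /forallNP/= free.
have far n : D < mdist (L n) (M n) by rewrite ltNge; exact/negP/free.
case: game => AL0 AM0 Lseg Lstep AMS Mstep; apply: A_bounded.
have AM n : A (M n) by case: n.
have LD n : mdist (L n) (L n.+1) = D by rewrite Lstep min_l// ltW.
have LLM n : between (L n) (L n.+1) (M n) by exact/(segment_between treeX).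
apply: (straight_chain_ray treeX A_convex D_gt0 _ LD _) => n.
  by elim: n => // n ALn; exact: A_convex ALn (AM n) _ (Lseg n).
(* The man's move has length at most [D], less than his distance to [L n.+1] after it. *)
have LLM' : between (L n) (L n.+1) (M n.+1).
  exact: (between_short_move treeX) (LLM n) (le_lt_trans (Mstep n) (far n.+1)).
exact: between_inner_right LLM' (LLM n.+1).
Qed.
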